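(* Let $R$ be an associative unital ring, let $\kappa\geq\operatorname{card}(R)+\aleph_0$ be a cardinal, let $\mathcal{D}$ be a $\kappa^+$-deconstructible class of right $R$-modules, and let $\mathcal{M}$ be either the class of all embeddings, all RD-embeddings, or all pure embeddings. Then $\mathbf{D}=(\mathcal{D},\leq_{\mathcal{M}})$ satisfies all the conditions in the definition of an abstract elementary class of modules except possibly for the Tarski--Vaught Axioms (A1). Furthermore, $\mathbf{D}$ is an abstract elementary class with $\operatorname{LS}(\mathbf{D})\leq\kappa$ if and only if $\mathcal{D}$ is closed under unions of $\mathcal{M}$-chains, i.e. $\bigcup_{i<\delta}A_i\in\mathcal{D}$ for every continuous $\leq_{\mathcal{M}}$-increasing chain $(A_i\mid i<\delta)$ in $\mathcal{D}$.
   Context: Modules are right $R$-modules; $\|M\|$ denotes the cardinality of a module $M$. For an infinite cardinal $\mu$, a module is $<\mu$-presented if it has a presentation with fewer than $\mu$ generators and fewer than $\mu$ relations. For a class $\mathcal{C}$ of modules, a module $M$ is $\mathcal{C}$-filtered if there are an ordinal $\delta$ and an increasing chain of submodules $(M_i\mid i\leq\delta)$ of $M$ with $M_0=0$, $M_\delta=M$, $M_i=\bigcup_{j<i}M_j$ for limit $i\leq\delta$, and $M_{i+1}/M_i$ isomorphic to a member of $\mathcal{C}$ for all $i<\delta$. A class $\mathcal{D}$ is $\mu$-deconstructible if $\mathcal{D}$ is exactly the class of all $\mathcal{D}^{<\mu}$-filtered modules, where $\mathcal{D}^{<\mu}$ is the class of all $<\mu$-presented modules in $\mathcal{D}$. An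 embedding is a monomorphism. A submodule $N$ of $M$ is an RD-submodule if $N\cap Mr=Nr$ for all $r\in R$; it is a pure submodule if every finite system of $R$-linear equations with right-hand side in $N$ that is solvable in $M$ is solvable in $N$. An RD-embedding (pure embedding) is a monomorphism whose image is an RD-submodule (pure submodule) of its codomain. For $A,B\in\mathcal{D}$, $A\leq_{\mathcal{M}}B$ means that $A$ is a submodule of $B$ and the inclusion is in $\mathcal{M}$. An abstract class of modules is a pair $\mathbf{A}=(\mathcal{A},\lesssim)$ with $\mathcal{A}$ a class of modules and $\lesssim$ a partial order on $\mathcal{A}$ such that $A\lesssim B$ implies $A$ is a submodule of $B$, and both $\mathcal{A}$ and $\lesssim$ are closed under isomorphisms. A chain $(A_i\mid i<\delta)$ indexed by an ordinal is continuous $\lesssim$-increasing if $A_i\lesssim A_j$ for $i\leq j<\delta$ and $A_i=\bigcup_{j<i}A_j$ for limit $i<\delta$. $\mathbf{A}$ is an abstract elementary class (AEC) of modules if: (A1) Tarski--Vaught Axioms: for every continuous $\lesssim$-increasing chain $(A_i\mid i<\delta)$ in $\mathcal{A}$: (1) $\bigcup_{i<\delta}A_i\in\mathcal{A}$; (2) $A_j\lesssim\bigcup_{i<\delta}A_i$ for each $j<\delta$; (3) if $M\in\mathcal{A}$ and $A_i\lesssim M$ for each $i<\delta$, then $\bigcup_{i<\delta}A_i\lesssim M$. (A2) Coherence: if $A,B,C\in\mathcal{A}$, $A\lesssim C$, $B\lesssim C$, and $A$ is a submodule of $B$, then $A\lesssim B$. (A3) L\''owenheim--Skolem--Tarski Axiom: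 there is a cardinal $\lambda$ such that whenever $A$ is a submodule of $B\in\mathcal{A}$ there is $A'\in\mathcal{A}$ with $A\subseteq A'\lesssim B$ and $\|A'\|\leq\|A\|+\lambda$. The least such infinite $\lambda\geq\operatorname{card}(R)$ is denoted $\operatorname{LS}(\mathbf{A})$. *)

(* Defs.v *)
From HB Require Import structures.
From mathcomp Require Import all_boot all_algebra ring_quotient.
From mathcomp Require Import boolp classical_sets functions cardinality.
From mathcomp Require Import wochoice.

Set Implicit Arguments.
Unset Strict Implicit.
Unset Printing Implicit Defensive.

Import GRing.Theory.

Local Open Scope ring_scope.
Local Open Scope card_scope.

(* Right R-modules are left modules over the opposite ring: for x in a right
   module and r : R, the expression r *: x stands for x r. *)
Notation rmodType R := (lmodType R^c).

(* [cardinal] is the universe of carriers of modules; it is named explicitly so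
   that a cardinal (a type up to equipotence) or an ordinal (a well-ordered
   type) cannot live above the class of all modules, which would for instance
   trivialize the existence of a Loewenheim-Skolem-Tarski cardinal. *)
Definition cardinal := Type@{GRing.Lmodule.axioms_.u0}.

Definition card_lt (T U : Type) (A : set T) (B : set U) : Prop :=
  A #<= B /\ ~ (B #<= A).

Definition succ_cardinal (K mu : cardinal) : Prop :=
  card_lt [set: K]%classic [set: mu]%classic /\
  forall X : cardinal,
    card_lt [set: K]%classic [set: X]%classic ->
    [set: mu]%classic #<= [set: X]%classic.

(* Every nonempty subset has a unique least element: this makes [ord_le] a
   total order. *)
Record wordinal := Wordinal {
  ord_car :> Type@{GRing.Lmodule.axioms_.u0};
  ord_le : rel ord_car;
  ord_wo : well_order ord_le }.

Section Ordinals.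
Variable I : wordinal.

Definition ord_lt (i j : I) : Prop := ord_le i j /\ i <> j.
Definition ord_is_zero (i : I) : Prop := forall j, ord_le i j.
Definition ord_is_top (i : I) : Prop := forall j, ord_le j i.
Definition ord_is_succ (i j : I) : Prop :=
  ord_lt i j /\ forall k, ord_lt i k -> ord_le j k.
Definition ord_is_limit (j : I) : Prop :=
  ~ ord_is_zero j /\ forall i, ~ ord_is_succ i j.

End Ordinals.

(* A submodule of V is a bundled predicate S : submodClosed V; [submod S] is S
   regarded as a module, and [val] is the inclusion map. *)
Definition submod (A : pzRingType) (V : lmodType A) (S : submodClosed V) :=
  {x : V | x \in S}.

HB.instance Definition _ (A : pzRingType) (V : lmodType A)
  (S : submodClosed V) := SubChoice.on (submod S).
HB.instance Definition _ (A : pzRingType) (V : lmodType A)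
  (S : submodClosed V) := [SubChoice_isSubLmodule of submod S by <:].

Definition submod_incl (A : pzRingType) (V : lmodType A) (S : submodClosed V) :
  {linear submod S -> V} := val.

Section SubmoduleConstructions.
Variables (A : pzRingType) (V : lmodType A).

(* S :&: T as a submodule of S. *)
Definition restrict_pred (S T : submodClosed V) : {pred submod S} :=
  [pred x | val x \in T].
Fact restrict_closed S T : subsemimod_closed (@restrict_pred S T).
Proof.
split; first split.
- by rewrite !inE raddf0 rpred0.
- by move=> x y; rewrite !inE raddfD => *; apply: rpredD.
- by move=> a x; rewrite !inE linearZ => *; apply: rpredZ.
Qed.
HB.instance Definition _ S T :=
  GRing.isSubmodClosed.Build A (submod S) (@restrict_pred S T)
    (restrict_closed S T).
Definition restrict_submod (S T : submodClosed V) : submodClosed (submod S) :=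
  @restrict_pred S T.

Definition span_pred (Y : set V) : {pred V} :=
  [pred x | `[< forall S : submodClosed V,
                  (forall y, Y y -> y \in S) -> x \in S >]].
Fact span_closed Y : subsemimod_closed (span_pred Y).
Proof.
split; first split.
- by apply/asboolP => S _; apply: rpred0.
- move=> x y /asboolP Hx /asboolP Hy; apply/asboolP => S YS.
  by apply: rpredD; [apply: Hx|apply: Hy].
- move=> a x /asboolP Hx; apply/asboolP => S YS.
  by apply: rpredZ; apply: Hx.
Qed.
HB.instance Definition _ Y :=
  GRing.isSubmodClosed.Build A V (span_pred Y) (span_closed Y).
Definition span_submod (Y : set V) : submodClosed V := span_pred Y.

Definition image_pred (W : lmodType A) (f : {linear W -> V}) : {pred V} :=
  [pred y | `[< exists x, f x = y >]].
Fact image_closed W f : subsemimod_closed (@image_pred W f).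
Proof.
split; first split.
- by apply/asboolP; exists 0; rewrite raddf0.
- move=> _ _ /asboolP[x <-] /asboolP[y <-]; apply/asboolP.
  by exists (x + y); rewrite raddfD.
- move=> a _ /asboolP[x <-]; apply/asboolP.
  by exists (a *: x); rewrite linearZ.
Qed.
HB.instance Definition _ W f :=
  GRing.isSubmodClosed.Build A V (@image_pred W f) (image_closed f).
Definition image_submod (W : lmodType A) (f : {linear W -> V}) :
  submodClosed V := image_pred f.

End SubmoduleConstructions.

Section QuotientModule.
Variables (A : pzRingType) (V : lmodType A) (S : submodClosed V).
Local Open Scope quotient_scope.

(* S with its structure of additive subgroup, as [ring_quotient] requires. *)
Definition zmod_pred : {pred V} := [pred x | x \in S].
Fact zmod_pred_closed : subsemimod_closed zmod_pred.
Proof.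
split; first split; first exact: rpred0.
  by move=> x y; apply: rpredD.
by move=> a x; apply: rpredZ.
Qed.
HB.instance Definition _ :=
  GRing.isSubmodClosed.Build A V zmod_pred zmod_pred_closed.

Definition quotmod := Quotient.quot zmod_pred.
HB.instance Definition _ := GRing.Zmodule.on quotmod.

Definition quot_scale (a : A) (q : quotmod) : quotmod :=
  \pi_(Quotient.quot zmod_pred) (a *: repr q).

Fact pi_quot_scale a (x : V) :
  quot_scale a (\pi_(Quotient.quot zmod_pred) x) =
  \pi_(Quotient.quot zmod_pred) (a *: x).
Proof.
rewrite /quot_scale; apply/eqP; rewrite -Quotient.idealrBE -scalerBr.
by apply: rpredZ; rewrite Quotient.idealrBE reprK.
Qed.

Fact quot_scalerA a b q : quot_scale a (quot_scale b q) = quot_scale (a * b) q.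
Proof.
elim/quotW: q => x; rewrite (pi_quot_scale b) (pi_quot_scale a).
by rewrite (pi_quot_scale (a * b)) scalerA.
Qed.
Fact quot_scale1r : left_id 1 quot_scale.
Proof. by elim/quotW=> x; rewrite (pi_quot_scale 1) scale1r. Qed.
Fact quot_scalerDr : right_distributive quot_scale +%R.
Proof.
move=> a; elim/quotW=> x; elim/quotW=> y.
by rewrite -raddfD !(pi_quot_scale a) scalerDr raddfD.
Qed.
Fact quot_scalerDl q : {morph quot_scale^~ q : a b / a + b}.
Proof.
move=> a b; elim/quotW: q => x; rewrite (pi_quot_scale (a + b)) scalerDl raddfD.
by congr (_ + _); exact/esym/pi_quot_scale.
Qed.

HB.instance Definition _ := GRing.Zmodule_isLmodule.Build A quotmod
  quot_scalerA quot_scale1r quot_scalerDr quot_scalerDl.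

End QuotientModule.

Section FreeModule.
Variables (R : pzRingType) (X : cardinal).

(* The right module R^(X) of finitely supported functions X -> R. *)
Definition finsupp_pred : {pred X -> (R^c)^o} :=
  [pred f | `[< finite_set [set x | f x != 0]%classic >]].
Fact finsupp_closed : subsemimod_closed finsupp_pred.
Proof.
split; first split.
- apply/asboolP; apply: (sub_finite_set _ (finite_set0 X)) => x /=.
  by rewrite eqxx.
- move=> f g /asboolP Hf /asboolP Hg; apply/asboolP.
  apply: (sub_finite_set (B := _ `|` _)%classic); last first.
    by rewrite finite_setU; split; [exact: Hf|exact: Hg].
  move=> x /= fg0; case: (eqVneq (f x) 0) => [f0|]; [right|by left].
  by apply: contra fg0 => /eqP g0; rewrite /GRing.add /= f0 g0 addr0.
- move=> a f /asboolP Hf; apply/asboolP.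
  apply: (sub_finite_set _ Hf) => x /=.
  by apply: contra => /eqP f0; rewrite /GRing.scale /= f0 scaler0.
Qed.
HB.instance Definition _ :=
  GRing.isSubmodClosed.Build R^c (X -> (R^c)^o) finsupp_pred finsupp_closed.

Definition free_rmod : rmodType R := submod finsupp_pred.

End FreeModule.

Section ModuleClasses.
Variable R : pzRingType.
Implicit Types (C D : rmodType R -> Prop) (M N B : rmodType R).

Definition isomorphic M N : Prop := exists f : {linear M -> N}, bijective f.

(* < mu -presented: M is isomorphic to R^(X)/<Y> with |X|, |Y| < mu. *)
Definition lt_presented (mu : cardinal) M : Prop :=
  exists (X : cardinal) (Y : set (free_rmod R X)),
    [/\ card_lt [set: X]%classic [set: mu]%classic,
        card_lt Y [set: mu]%classic
      & isomorphic M (quotmod (span_submod Y))].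

(* The ordinals i <= delta are the elements of a well-ordered type J with a
   greatest element t, which plays the role of delta. *)
Definition filtered C M : Prop :=
  exists (J : wordinal) (t : J) (F : J -> submodClosed M),
    [/\ ord_is_top t,
        (forall i j, ord_le i j -> {subset F i <= F j}),
        ((forall i, ord_is_zero i -> forall x, (x \in F i) = (x == 0)) /\
         forall x, x \in F t),
        (forall i, ord_is_limit i -> forall x,
           x \in F i <-> exists2 j, ord_lt j i & x \in F j)
      & (forall i j, ord_is_succ i j ->
           exists2 N, C N &
             isomorphic (quotmod (restrict_submod (F j) (F i))) N)].

Definition deconstructible (mu : cardinal) D : Prop :=
  forall M, D M <-> filtered (fun N => D N /\ lt_presented mu N) M.

Definition RD_submodule M (N : submodClosed M) : Prop :=
  forall (r : R^c) (x : M),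
    (x \in N /\ exists y : M, x = r *: y) <-> exists2 y, y \in N & x = r *: y.

Definition pure_submodule M (N : submodClosed M) : Prop :=
  forall (m n : nat) (r : 'I_m -> 'I_n -> R^c) (b : 'I_m -> M),
    (forall i, b i \in N) ->
    (exists x : 'I_n -> M, forall i, \sum_(j < n) r i j *: x j = b i) ->
    exists x : 'I_n -> M, (forall j, x j \in N) /\
      forall i, \sum_(j < n) r i j *: x j = b i.

Definition embedding M N (f : {linear M -> N}) : Prop := injective f.
Definition RD_embedding M N (f : {linear M -> N}) : Prop :=
  injective f /\ RD_submodule (image_submod f).
Definition pure_embedding M N (f : {linear M -> N}) : Prop :=
  injective f /\ pure_submodule (image_submod f).

(* The data of a class of modules with a relation A <~ B on it.  As A <~ B
   entails that A is a submodule of B, the relation is given as a predicate on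
   the pairs (B, A) with A a submodule of B. *)
Record rmod_class := RmodClass {
  rc_mem : rmodType R -> Prop;
  rc_le : forall B : rmodType R, submodClosed B -> Prop }.

Implicit Type K : rmod_class.

(* A <~ B for modules A, B given as submodules of a common ambient module. *)
Definition strong K M (A B : submodClosed M) : Prop :=
  {subset A <= B} /\ rc_le K (restrict_submod B A).

Definition abstract_class K : Prop :=
  [/\ (forall B (A : submodClosed B), rc_le K A ->
         rc_mem K (submod A) /\ rc_mem K B),
      [/\ (forall M (A : submodClosed M), rc_mem K (submod A) -> strong K A A),
          (forall M (A B : submodClosed M),
             strong K A B -> strong K B A -> A =i B)
        & (forall M (A B C : submodClosed M),
             strong K A B -> strong K B C -> strong K A C)],
      (forall M N, isomorphic M N -> rc_mem K M -> rc_mem K N)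
    & (forall B B' (f : {linear B -> B'}) (A : submodClosed B)
              (A' : submodClosed B'),
         bijective f -> (forall x, (f x \in A') = (x \in A)) ->
         rc_le K A -> rc_le K A')].

(* The members of a chain are represented as submodules of an ambient module M
   (for instance their union), which is not required to belong to the class. *)
Definition strong_chain K M (I : wordinal) (F : I -> submodClosed M) : Prop :=
  [/\ (forall i, rc_mem K (submod (F i))),
      (forall i j, ord_le i j -> strong K (F i) (F j))
    & (forall i, ord_is_limit i -> forall x,
         x \in F i <-> exists2 j, ord_lt j i & x \in F j)].

(* For the empty chain there is no such U, as a submodule is nonempty. *)
Definition is_union M (I : wordinal) (F : I -> submodClosed M)
    (U : submodClosed M) : Prop :=
  forall x, x \in U <-> exists i, x \in F i.

Fact ord_total (I : wordinal) (i j : I) : ord_le i j \/ ord_le j i.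
Proof.
pose P : {pred I} := [pred k | `[< k = i \/ k = j >]].
have [|k [[/asboolP kij kP] _]] := @ord_wo I P.
  by exists i; apply/asboolP; left.
case: kij => kE; [left|right]; rewrite -kE; apply: kP; apply/asboolP; auto.
Qed.

(* The union of a nonempty chain is a submodule. *)
Fact is_union_exists K M (I : wordinal) (F : I -> submodClosed M) (i0 : I) :
  strong_chain K F -> exists U : submodClosed M, is_union F U.
Proof.
move=> [_ inc _].
pose P : {pred M} := [pred x | `[< exists i, x \in F i >]].
have Pc : subsemimod_closed P.
  split; first split.
  - by apply/asboolP; exists i0; apply: rpred0.
  - move=> x y /asboolP[i xi] /asboolP[j yj]; apply/asboolP.
    case: (ord_total i j) => /inc[sub _].
      by exists j; apply: rpredD => //; apply: sub.
    by exists i; apply: rpredD => //; apply: sub.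
  - move=> a x /asboolP[i xi]; apply/asboolP; exists i; exact: rpredZ.
pose m := GRing.isSubmodClosed.Build R^c M P Pc.
pose U : submodClosed M := HB.pack P m.
by exists U => x; split=> [/asboolP|h]; last apply/asboolP.
Qed.

Definition closed_under_unions K : Prop :=
  forall M (I : wordinal) (F : I -> submodClosed M) (U : submodClosed M),
    strong_chain K F -> is_union F U -> rc_mem K (submod U).

Definition tarski_vaught K : Prop :=
  forall M (I : wordinal) (F : I -> submodClosed M) (U : submodClosed M),
    strong_chain K F -> is_union F U ->
    [/\ rc_mem K (submod U),
        (forall j, strong K (F j) U)
      & (forall N : submodClosed M, rc_mem K (submod N) ->
           (forall i, strong K (F i) N) -> strong K U N)].

Definition coherence K : Prop :=
  forall M (A B C : submodClosed M),
    rc_mem K (submod A) -> rc_mem K (submod B) -> rc_mem K (submod C) ->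
    strong K A C -> strong K B C -> {subset A <= B} -> strong K A B.

Definition lst_bound K (L : cardinal) : Prop :=
  forall B, rc_mem K B -> forall A : submodClosed B,
    exists A' : submodClosed B,
      [/\ rc_mem K (submod A'), {subset A <= A'}, rc_le K A'
        & [set: submod A']%classic #<= [set: submod A + L]%classic].

Definition lowenheim_skolem_tarski K : Prop :=
  exists L : cardinal, lst_bound K L.

Definition is_AEC K : Prop :=
  [/\ abstract_class K, tarski_vaught K, coherence K
    & lowenheim_skolem_tarski K].

Definition LS_candidate K (L : cardinal) : Prop :=
  [/\ infinite_set [set: L]%classic, [set: R]%classic #<= [set: L]%classic
    & lst_bound K L].

(* L represents the cardinal LS(K). *)
Definition is_LS K (L : cardinal) : Prop :=
  LS_candidate K L /\
  forall L' : cardinal, LS_candidate K L' ->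
    [set: L]%classic #<= [set: L']%classic.

(* The pair (D, <=_M) for a class E of monomorphisms. *)
Definition class_of D
    (E : forall M N : rmodType R, {linear M -> N} -> Prop) : rmod_class :=
  {| rc_mem := D;
     rc_le := fun B (A : submodClosed B) =>
       [/\ D (submod A), D B & E _ _ (submod_incl A)] |}.

End ModuleClasses.

(* Main.v *)
Require Import Defs.
From HB Require Import structures.
From mathcomp Require Import all_boot all_algebra ring_quotient.
From mathcomp Require Import boolp classical_sets functions cardinality.
From mathcomp Require Import wochoice.

Set Implicit Arguments.
Unset Strict Implicit.
Unset Printing Implicit Defensive.

Import GRing.Theory.

Local Open Scope ring_scope.
Local Open Scope card_scope.

(** The relation of the class is generated by a purity condition: the inclusion
    of A in B lies in M exactly when every linear system of an allowed size
    with right-hand sides in A that is solvable in B is solvable in A.  No size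
    is allowed for embeddings, only one equation in one unknown for
    RD-embeddings, and every size for pure embeddings.  This condition is
    reflexive and transitive, holds for A in any B between A and C if it holds
    for A in C (which is coherence) and, as a system involves finitely many
    elements, passes to unions of chains.  So the
    axioms on the order hold, and among the Tarski-Vaught axioms only the
    membership of the union in D is at stake; this gives the equivalence once
    the Loewenheim-Skolem-Tarski axiom is known to hold with bound kappa.

    For that axiom, let B be in D with a filtration F_j whose successive
    factors are at most kappa-presented, hence have at most kappa elements.
    Choose for each x in F_(j+1) outside F_j a family of kappa representatives
    of all cosets of F_(j+1)/F_j.  Given a submodule A, let A' be its closure
    under addition, scalars, a chosen solution of each solvable linear system
    over A', and these representatives (deconstructible_submodule).  Then A' is
    pure in B.  The submodules F_j of B, intersected with A', filter A': if A'
    meets F_(j+1) outside F_j it meets every coset, and the factor is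
    F_(j+1)/F_j; otherwise the factor is 0 (filtration_preimage).  So A' is in
    D.  This replaces the Hill lemma: instead of subsets of the index set
    closed for chosen generators, one closes the submodule itself under
    operations.

    The bound on the cardinality of A' comes from naming its elements by finite
    trees (closure_exists) and from the equality of an infinite cardinal with
    its square (inj_le_square).  The latter and the existence of a least
    cardinal LS (inj_le_min) are proved with Zorn's lemma. *)

(** * Cardinal arithmetic *)

Definition inj_le (T U : Type) : Prop := exists f : T -> U, injective f.

Lemma card_leTP (T U : Type) :
  ([set: T]%classic #<= [set: U]%classic) <-> inj_le T U.
Proof.
split=> [/card_leP[f]|[f f_inj]].
  exists (fun x => val (f (SigSub (mem_setT x)))) => x y /val_inj fxy.
  have : SigSub (mem_setT x) = SigSub (mem_setT y).
    by apply: (inj (f := f)) fxy; rewrite inE.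
  by case.
have : ((f @` setT)%classic #= [set: T]%classic)%card.
  by apply: inj_card_eq => x y _ _; apply: f_inj.
rewrite card_eq_le => /andP[_ ge].
exact: card_le_trans ge (card_leT _).
Qed.

Lemma inj_le_refl (T : Type) : inj_le T T.
Proof. by exists id. Qed.

Lemma inj_le_trans (U T V : Type) : inj_le T U -> inj_le U V -> inj_le T V.
Proof. by move=> [f fI] [g gI]; exists (g \o f); apply: inj_comp. Qed.

Lemma surj_inj_le (T U : Type) (f : T -> U) :
  (forall y, exists x, f x = y) -> inj_le U T.
Proof.
by move=> /choice[g gK]; exists g; apply: can_inj gK.
Qed.

Lemma inj_le_sig (T : Type) (P : T -> Prop) : inj_le {x | P x} T.
Proof.
by exists sval => -[x Px] [y Py] /= xy; apply: eq_exist.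
Qed.

(** Comparability and well-foundedness of cardinals at once.  A set S of choice
    functions that is maximal among those on which every coordinate is
    injective has some surjective coordinate i: else a function avoiding S in
    all coordinates could be added.  Then X i is in bijection with S, which
    injects into each X j. *)
Lemma inj_le_min (I : Type) (i0 : I) (X : I -> Type) :
  exists i, forall j, inj_le (X i) (X j).
Proof.
pose P (S : set (forall i, X i)) :=
  forall i a b, S a -> S b -> a i = b i -> a = b.
have [|S [PS Smax]] := @Zorn_bigcup _ P.
  move=> F FP Ftot i a b [A FA Aa] [B FB Bb].
  by have [AB|BA] := Ftot _ _ FA FB;
    [apply: (FP _ FB i) => //; apply: AB|apply: (FP _ FA i) => //; apply: BA].
have [i iS] : exists i, forall x, exists a, S a /\ a i = x.
  apply: contrapT => nS.
  have nx i : exists x, forall a, S a -> a i <> x.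
    apply: contrapT => ni; apply: nS; exists i => x.
    apply: contrapT => nx; apply: ni; exists x => a Sa ax; apply: nx.
    by exists a.
  pose b i := sval (cid (nx i)).
  have bP i a : S a -> a i <> b i by rewrite /b; case: cid => x /= + Sa; apply.
  apply: (Smax (fun a => S a \/ a = b)%classic).
    split=> [a Sa|]; first by left.
    by move=> /(_ b (or_intror erefl)) /(bP i0).
  move=> i c d [Sc|->] [Sd|->] // cd; first exact: PS cd.
    by case: (bP i _ Sc).
  by case: (bP i _ Sd).
have [g gP] := choice iS.
exists i => j; exists (fun x => g x j) => x y /PS gxy.
by rewrite -(proj2 (gP x)) -(proj2 (gP y)) gxy //; apply: (proj1 (gP _)).
Qed.

Lemma inj_le_total (T U : Type) : inj_le T U \/ inj_le U T.
Proof.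
have [[] le] := inj_le_min true (fun b : bool => if b then T else U).
  by left; apply: (le false).
by right; apply: (le true).
Qed.

Section Pairing.
Variable K : Type.

Definition dom (G : set (K * K * K)) : set K :=
  fun x => exists y z, G (x, y, z).

(** A pairing G is the graph of a relation between pairs of elements of a set A
    and their codes in A, where each pair has a code and each code belongs to
    one pair.  The set A is recovered as the first coordinates of G, so that
    the extensions in Zorn's lemma are inclusions of graphs. *)
Definition pairing (G : set (K * K * K)) : Prop :=
  [/\ (forall x y z, G (x, y, z) -> [/\ dom G x, dom G y & dom G z]),
      (forall x y, dom G x -> dom G y -> exists z, G (x, y, z))
    & (forall x y x' y' z, G (x, y, z) -> G (x', y', z) ->
         x = x' /\ y = y')].

Lemma pairing_bigcup (F : set (set (K * K * K))) :
  (F `<=` pairing -> total_on F subset -> pairing (\bigcup_(G in F) G))%classic.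
Proof.
move=> Fp Ftot.
have domS G x : F G -> dom G x -> dom (\bigcup_(G in F) G)%classic x.
  by move=> FG [y [z Gxyz]]; exists y, z, G.
have max G H : F G -> F H ->
    exists L, [/\ F L, (G `<=` L)%classic & (H `<=` L)%classic].
  move=> FG FH; have [GH|HG] := Ftot _ _ FG FH.
    by exists H; split.
  by exists G; split.
split.
- move=> x y z [G FG Gxyz].
  by have [/(_ _ _ _ Gxyz)[dx dy dz] _ _] := Fp _ FG; split; apply: domS FG _.
- move=> x y [x1 [x2 [G FG Gx]]] [y1 [y2 [H FH Hy]]].
  have [L [FL GL HL]] := max _ _ FG FH.
  have [_ + _] := Fp _ FL => /(_ x y)[||z Lz].
  + by exists x1, x2; apply: GL.
  + by exists y1, y2; apply: HL.
  by exists z, L.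
- move=> x y x' y' z [G FG Gx] [H FH Hx].
  have [L [FL GL HL]] := max _ _ FG FH.
  by have [_ _ inj] := Fp _ FL; apply: inj (GL _ Gx) (HL _ Hx).
Qed.

Lemma pairing_inj (G : set (K * K * K)) (A := {x | dom G x}) : pairing G ->
  exists2 f : A * A -> A, injective f &
    forall a b, G (sval a, sval b, sval (f (a, b))).
Proof.
move=> [Gdom Gtot Ginj].
have ex (u : A * A) : exists c : A, G (sval u.1, sval u.2, sval c).
  have [z Gz] := Gtot _ _ (svalP u.1) (svalP u.2).
  by have [_ _ dz] := Gdom _ _ _ Gz; exists (exist _ z dz).
have [f fP] := choice ex.
exists f => [[a b] [a' b'] fab|a b]; last exact: fP (a, b).
have := fP (a, b); rewrite fab => /Ginj/(_ (fP (a', b')))/=[].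
move: a b a' b' {fab} => [a ?] [b ?] [a' ?] [b' ?] /=.
move=> aa bb; congr pair; exact: eq_exist.
Qed.

End Pairing.

Lemma inj_le_sum (T U V W : Type) :
  inj_le T V -> inj_le U W -> inj_le (T + U) (V + W).
Proof.
move=> [f fI] [g gI].
exists (fun s => match s with inl x => inl (f x) | inr y => inr (g y) end).
by move=> [x|x] [y|y] // [] => [/fI|/gI] ->.
Qed.

Lemma inj_le_prod (T U V W : Type) :
  inj_le T V -> inj_le U W -> inj_le (T * U) (V * W).
Proof.
move=> [f fI] [g gI]; exists (fun s => (f s.1, g s.2)).
by move=> [x y] [x' y'] [/fI-> /gI->].
Qed.

Lemma inj_le_sum_square (A : Type) :
  inj_le nat A -> inj_le (A * A) A -> inj_le (A + A) A.
Proof.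
move=> [e eI] AA; apply: inj_le_trans AA.
exists (fun s => match s with inl x => (e 0, x) | inr y => (e 1, y) end)%N.
by move=> [x|x] [y|y] []; do ?[move=> /eI//]; move=> ->.
Qed.

(** Hessenberg's theorem.  Start from a pairing on a copy of nat in K and take
    a maximal extension, on a set A.  If the complement of A injects into A,
    then K injects into A + A, hence into A * A and A, and the pairing of A
    yields one of K.  Otherwise A has a disjoint copy A1 in K, and the pairing
    extends to the union of A and A1: this union injects into A by c, so the
    new pairs (x, y) can be given the codes h (f (c x, c y)) in A1, distinct
    from the codes in A; this contradicts maximality. *)
Lemma inj_le_square (K : Type) : inj_le nat K -> inj_le (K * K) K.
Proof.
move=> [e eI].
have [q qI] : inj_le (nat * nat) nat.
  by apply/card_leTP; move: card_nat2; rewrite card_eq_le => /andP[].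
pose G0 : set (K * K * K) :=
  fun u => exists a b, u = (e a, e b, e (q (a, b))).
have dom0 x : dom G0 x <-> exists a, x = e a.
  split=> [[y [z [a [b [-> _ _]]]]]|[a ->]]; first by exists a.
  by exists (e 0%N), (e (q (a, 0%N))), a, 0%N.
have G0p : pairing G0.
  split=> [x y z [a [b [-> -> ->]]]|x y /dom0[a ->] /dom0[b ->]|].
  - by split; apply/dom0; [exists a|exists b|exists (q (a, b))].
  - by exists (e (q (a, b))), a, b.
  - move=> x y x' y' z [a [b [-> -> ->]]] [a' [b' [-> -> /eI]]].
    by move=> /qI[-> ->].
(* Taking the union with G0 inside the property makes every graph considered
   extend G0, while the union of the empty chain is still admissible. *)
have [F FP Ftot|G1 [Gp Gmax]] :=
  @Zorn_bigcup _ (fun G => pairing (G `|` G0)%classic).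
  have -> : (\bigcup_(X in F) X `|` G0 =
     \bigcup_(Y in ((fun X => X `|` G0) @` F `|` [set G0])) Y)%classic.
    apply/seteqP; split=> u.
      move=> [[X FX Xu]|G0u]; last by exists G0 => //; right.
      by exists (X `|` G0)%classic; [left; exists X|left].
    move=> [_ [[X FX <-]|->]]; last by right.
    by move=> [Xu|]; [left; exists X|right].
  apply: pairing_bigcup.
    by move=> _ [[X FX <-]|->] //; apply: FP.
  move=> _ _ [[X FX <-]|->] [[Y FY <-]|->].
  - by have [XY|YX] := Ftot _ _ FX FY; [left|right]; apply: setSU.
  - by right; apply: subsetUr.
  - by left; apply: subsetUr.
  - by left.
set G := (G1 `|` G0)%classic in Gp.
have [f fI fG] := pairing_inj Gp.
set A : Type := ({x | dom G x}) in f fI fG.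
have AA : inj_le (A * A) A by exists f.
have dG a : dom G (e a).
  have /dom0 [y [z G0z]] : exists b, e a = e b by exists a.
  by exists y, z; right.
have natA : inj_le nat A.
  exists (fun a => exist _ (e a) (dG a)) => a b /(congr1 sval)/=; exact: eI.
have A2 := inj_le_sum_square natA AA.
have [CA|[h hI]] := inj_le_total {x | ~ dom G x} A.
  have KA : inj_le K A.
    apply: inj_le_trans A2; apply: inj_le_trans (inj_le_sum (inj_le_refl A) CA).
    exists (fun x => match pselect (dom G x) with
      left d => inl (exist _ x d) | right d => inr (exist _ x d) end).
    by move=> x y; case: pselect => ?; case: pselect => ? // [].
  apply: inj_le_trans (inj_le_prod KA KA) _.
  exact: inj_le_trans AA (inj_le_sig _).
exfalso.
pose h' a := sval (h a).
have h'I : injective h'.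
  move=> a b; rewrite /h'; case: (h a) (h b) (hI a b) => x ? [y ?] /= E xy.
  by apply: E; apply: eq_exist.
have h'N a : ~ dom G (h' a) by rewrite /h'; case: (h a).
pose A1 : set K := fun x => dom G x \/ exists a, x = h' a.
have [c cI] : inj_le {x | A1 x} A.
  apply: inj_le_trans A2; apply: (surj_inj_le (f := fun s => match s with
    inl x => exist A1 (sval x) (or_introl (svalP x))
  | inr x => exist A1 (h' x) (or_intror (ex_intro _ x erefl)) end)).
  move=> [x [d|[a xa]]].
    by exists (inl (exist _ x d)); apply: eq_exist.
  by exists (inr a); apply: eq_exist.
pose G2 : set (K * K * K) := fun u => G u \/
  exists x y : {x | A1 x}, ~ (dom G (sval x) /\ dom G (sval y)) /\
    u = (sval x, sval y, h' (f (c x, c y))).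
have a0 : A := exist _ (e 0%N) (dG 0%N).
have A1dom x : A1 x -> dom G2 x.
  move=> A1x; pose y := exist A1 (h' a0) (or_intror (ex_intro _ a0 erefl)).
  exists (h' a0), (h' (f (c (exist _ x A1x), c y))); right.
  by exists (exist _ x A1x), y; split => // -[_]; apply: h'N.
have [Gdom Gtot Ginj] := Gp.
have domA1 x : dom G2 x -> A1 x.
  move=> [y [z [/Gdom[dx _ _]|[x' [y' [_ [-> _ _]]]]]]]; first by left.
  exact: svalP.
apply: (Gmax G2).
  split=> [u G1u|]; first by left; left.
  have : dom G2 (h' a0) by apply: A1dom; right; exists a0.
  move=> [y [z G2z]] /(_ _ G2z) G1z.
  by apply: (h'N a0); exists y, z; left.
have -> : (G2 `|` G0 = G2)%classic.
  apply/seteqP; split=> u; last by left.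
  by case=> // G0u; left; right.
split.
- move=> x y z [/Gdom[dx dy dz]|[x' [y' [_ [-> -> ->]]]]].
    by split; apply: A1dom; left.
  by split; apply: A1dom; do ?exact: svalP; right; eexists.
- move=> x y /domA1 dx /domA1 dy.
  have [[Gx Gy]|ND] := pselect (dom G x /\ dom G y).
    by have [z Gz] := Gtot _ _ Gx Gy; exists z; left.
  exists (h' (f (c (exist _ x dx), c (exist _ y dy)))); right.
  by exists (exist _ x dx), (exist _ y dy).
- move=> x y x' y' z [Gz|[u [v [_ [-> -> zE]]]]]
    [Gz'|[u' [v' [_ [-> -> zE']]]]].
  + exact: Ginj Gz Gz'.
  + by have [_ _] := Gdom _ _ _ Gz; rewrite zE' => /h'N.
  + by have [_ _] := Gdom _ _ _ Gz'; rewrite zE => /h'N.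
  + by move: zE'; rewrite zE => /h'I/fI[/cI-> /cI->].
Qed.

Section InfiniteType.
Variable K : Type.
Hypothesis Kinf : inj_le nat K.

Lemma inj_le_sumI (T U : Type) : inj_le T K -> inj_le U K -> inj_le (T + U) K.
Proof.
move=> TK UK; apply: inj_le_trans (inj_le_sum TK UK) _.
exact: inj_le_sum_square (inj_le_square Kinf).
Qed.

Lemma inj_le_prodI (T U : Type) : inj_le T K -> inj_le U K -> inj_le (T * U) K.
Proof.
move=> TK UK; apply: inj_le_trans (inj_le_prod TK UK) _.
exact: inj_le_square.
Qed.

Lemma inj_le_seqI (T : Type) : inj_le T K -> inj_le (seq T) K.
Proof.
move=> [f fI]; have [p pI] := inj_le_square Kinf.
have [e _] := Kinf.
suff : inj_le (seq T) (nat * K).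
  by move=> /inj_le_trans; apply; apply: inj_le_prodI => //; apply: inj_le_refl.
(* The length tells a list from its code, as the code of the empty list may
   coincide with that of another list. *)
exists (fun s => (size s, foldr (fun x k => p (f x, k)) (e 0%N) s)).
elim=> [|x s IHs] [|y t] //= [st /pI[/fI-> fst]].
by rewrite (IHs t) // st fst.
Qed.

Lemma inj_le_treeI (T : Type) : inj_le T K -> inj_le (GenTree.tree T) K.
Proof.
move=> TK; apply: (@inj_le_trans (seq (nat + T))).
  by exists (@GenTree.encode T); apply: pcan_inj (@GenTree.codeK T).
exact: inj_le_seqI (inj_le_sumI _ _).
Qed.

End InfiniteType.

(** The elements of the closure are the values of terms: a leaf is a generator,
    and an inner node carries an operation in its first child and the arguments
    in the other ones. *)
Lemma closure_exists (B : eqType) (X Idx : Type) (e : X -> B)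
    (op : Idx -> seq B -> B) :
  exists S : set B,
    [/\ forall x, S (e x),
        forall k s, {in s, forall y, S y} -> S (op k s)
      & inj_le {x | S x} (GenTree.tree (X + Idx))].
Proof.
pose run := fix run (t : GenTree.tree (X + Idx)) : option B :=
  match t with
  | GenTree.Leaf (inl x) => Some (e x)
  | GenTree.Node _ (GenTree.Leaf (inr k) :: ts) => Some (op k (pmap run ts))
  | _ => None
  end.
exists (fun y => exists t, run t = Some y); split.
- by move=> x; exists (GenTree.Leaf (inl x)).
- move=> k s sS.
  have [ts tsP] : exists ts, pmap run ts = s.
    elim: s sS => [|y s IHs] sS; first by exists [::].
    have [t ty] := sS y (mem_head y s).
    have [z zs|ts tsE] := IHs; last by exists (t :: ts); rewrite /= ty tsE.
    by apply: sS; rewrite inE zs orbT.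
  by exists (GenTree.Node 0 (GenTree.Leaf (inr k) :: ts)); rewrite /= tsP.
- have [g gP] := choice (fun u : {y | exists t, run t = Some y} => svalP u).
  exists g => -[x xP] [y yP] E; apply: eq_exist.
  by have := gP (exist _ x xP); rewrite E gP => -[].
Qed.

(** * Isomorphisms, quotients and filtrations *)

Section LinearAlgebra.
Variable R : pzRingType.
Implicit Types V W M N : rmodType R.

Lemma bijective_inj_surj (T U : Type) (f : T -> U) :
  injective f -> (forall y, exists x, f x = y) -> bijective f.
Proof.
move=> fI /choice[g fgK]; exists g => // x.
by apply: fI; rewrite fgK.
Qed.

Lemma bijective_surj (T U : Type) (f : T -> U) :
  bijective f -> forall y, exists x, f x = y.
Proof. by move=> [g _ fgK] y; exists (g y). Qed.

Lemma linear_pack V W (g : V -> W) :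
  (forall a x y, g (a *: x + y) = a *: g x + g y) ->
  exists f : {linear V -> W}, f =1 g.
Proof.
move=> glin; pose m := GRing.isLinear.Build R^c V W *:%R g glin.
pose f : {linear V -> W} := HB.pack g m.
by exists f.
Qed.

Lemma isomorphic_pack V W (g : V -> W) :
  (forall a x y, g (a *: x + y) = a *: g x + g y) ->
  injective g -> (forall y, exists x, g x = y) -> isomorphic V W.
Proof.
move=> /linear_pack[f fg] gI gS; exists f; apply: bijective_inj_surj.
  by move=> x y; rewrite !fg => /gI.
by move=> y; have [x <-] := gS y; exists x.
Qed.

Lemma isomorphic_sym V W : isomorphic V W -> isomorphic W V.
Proof.
move=> [f [g fK gK]]; apply: (@isomorphic_pack _ _ g).
- by move=> a x y; apply: (can_inj fK); rewrite linearP !gK.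
- exact: can_inj gK.
- by move=> y; exists (f y).
Qed.

Lemma trivial_isomorphic V W :
  (forall x : V, x = 0) -> (forall y : W, y = 0) -> isomorphic V W.
Proof.
move=> V0 W0; apply: (@isomorphic_pack _ _ (fun=> 0)).
- by move=> a x y; rewrite scaler0 addr0.
- by move=> x y _; rewrite (V0 x) (V0 y).
- by move=> y; exists 0; rewrite (W0 y).
Qed.

Lemma isomorphic_submod V W (f : {linear V -> W}) (S : submodClosed V)
    (T : submodClosed W) :
  bijective f -> (forall x, (f x \in T) = (x \in S)) ->
  isomorphic (submod S) (submod T).
Proof.
move=> fB fST.
have fS (x : submod S) : f (val x) \in T by rewrite fST (valP x).
apply: (@isomorphic_pack _ _ (fun x => exist _ (f (val x)) (fS x) : submod T)).
- by move=> a x y; apply: val_inj; rewrite /= linearP.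
- by move=> x y /(congr1 val)/(bij_inj fB)/val_inj.
- move=> [y yT]; have [x xy] := bijective_surj fB y.
  have xS : x \in S by rewrite -fST xy.
  by exists (exist _ x xS); apply: val_inj.
Qed.

Lemma submod_of_set V (S : set V) :
  S 0 -> (forall x y, S x -> S y -> S (x + y)) ->
  (forall a x, S x -> S (a *: x)) ->
  exists T : submodClosed V, forall x, x \in T <-> S x.
Proof.
move=> S0 SD SZ; pose P : {pred V} := [pred x | `[< S x >]].
have Pc : subsemimod_closed P.
  split; [split; first exact/asboolP|].
    by move=> x y /asboolP Sx /asboolP Sy; apply/asboolP; apply: SD.
  by move=> a x /asboolP Sx; apply/asboolP; apply: SZ.
pose m := GRing.isSubmodClosed.Build R^c V P Pc.
pose T : submodClosed V := HB.pack P m.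
by exists T => x; split=> [/asboolP|?]; last apply/asboolP.
Qed.

Section Quotients.
Variables (V : rmodType R) (S : submodClosed V).

Definition quot_pi (x : V) : quotmod S :=
  \pi_(Quotient.quot (zmod_pred S))%qT x.

Lemma quot_piP a x y : quot_pi (a *: x + y) = a *: quot_pi x + quot_pi y.
Proof.
rewrite /quot_pi raddfD /=; congr (_ + _).
exact: esym (@pi_quot_scale _ _ S a x).
Qed.

Lemma quot_pi0 : quot_pi 0 = 0.
Proof. by have := quot_piP (-1) 0 0; rewrite scaler0 addr0 scaleN1r addNr. Qed.

Lemma quot_pi_eq x y : quot_pi x = quot_pi y <-> x - y \in S.
Proof.
rewrite -[x - y \in S]/(x - y \in zmod_pred S).
rewrite Quotient.idealrBE; exact: (rwP eqP).
Qed.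

Lemma quot_pi_eq0 x : quot_pi x = 0 <-> x \in S.
Proof. by rewrite -quot_pi0 quot_pi_eq subr0. Qed.

Lemma quot_pi_surj q : exists x, quot_pi x = q.
Proof. by exists (repr q); apply: reprK. Qed.

Lemma quotient_isomorphic W (f : {linear V -> W}) :
  (forall y, exists x, f x = y) -> (forall x, f x = 0 <-> x \in S) ->
  isomorphic (quotmod S) W.
Proof.
move=> fS fK.
have fE x y : quot_pi x = quot_pi y <-> f x = f y.
  split=> [/quot_pi_eq/fK/eqP|fxy].
    by rewrite linearB subr_eq0 => /eqP.
  by apply/quot_pi_eq/fK; rewrite linearB fxy subrr.
pose s (q : quotmod S) : V := repr q.
have sK q : quot_pi (s q) = q by apply: reprK.
apply: (@isomorphic_pack _ _ (fun q => f (s q))).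
- by move=> a p q; rewrite -linearP; apply/fE; rewrite quot_piP !sK.
- by move=> p q /fE; rewrite !sK.
- by move=> y; have [x <-] := fS y; exists (quot_pi x); apply/fE; rewrite sK.
Qed.

End Quotients.

Section Preimage.
Variables (V W : rmodType R) (h : {linear W -> V}) (S : submodClosed V).

Definition preimage_pred : {pred W} := [pred x | h x \in S].
Fact preimage_closed : subsemimod_closed preimage_pred.
Proof.
split; first split.
- by rewrite !inE linear0 rpred0.
- by move=> x y; rewrite !inE raddfD => *; apply: rpredD.
- by move=> a x; rewrite !inE linearZ => *; apply: rpredZ.
Qed.
HB.instance Definition _ :=
  GRing.isSubmodClosed.Build R^c W preimage_pred preimage_closed.
Definition preimage_submod : submodClosed W := preimage_pred.

End Preimage.

(** [filtered] with its index set and chain as parameters, so that a chain can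
    be transformed on the same index set. *)
Definition filtration (C : rmodType R -> Prop) M (J : wordinal) (t : J)
    (F : J -> submodClosed M) : Prop :=
  [/\ ord_is_top t,
      (forall i j, ord_le i j -> {subset F i <= F j}),
      ((forall i, ord_is_zero i -> forall x, (x \in F i) = (x == 0)) /\
       forall x, x \in F t),
      (forall i, ord_is_limit i -> forall x,
         x \in F i <-> exists2 j, ord_lt j i & x \in F j)
    & (forall i j, ord_is_succ i j ->
         exists2 N, C N &
           isomorphic (quotmod (restrict_submod (F j) (F i))) N)].

(** Injectivity of h makes the preimage of 0 trivial, and preimages commute with
    the unions at limits.  At a successor, h^-1(F_j)/h^-1(F_i)
    embeds in F_j/F_i; the last hypothesis says that it is either 0 or all of
    F_j/F_i.  Isomorphisms of modules always fall in the second case. *)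
Lemma filtration_preimage (C : rmodType R -> Prop) V W (h : {linear W -> V})
    (J : wordinal) (t : J) (F : J -> submodClosed V) :
  injective h -> (forall N, (forall x : N, x = 0) -> C N) ->
  filtration C t F ->
  (forall i j, ord_is_succ i j ->
     (forall w, h w \in F j -> h w \in F i) \/
     (forall y, y \in F j -> exists2 w, h w \in F j & y - h w \in F i)) ->
  filtration C t (fun j => preimage_submod h (F j)).
Proof.
move=> hI C0 [top mono [F0 Ft] Flim Fsucc] jump; split=> //.
- by move=> i j /mono Fij x; rewrite !inE; apply: Fij.
- split=> [i /F0 Fi x|x]; rewrite inE; last exact: Ft.
  by rewrite Fi -(inj_eq hI) linear0.
- by move=> i /Flim Fi x; rewrite inE Fi; split=> -[j ji Fj]; exists j.
move=> i j ij; have [Wij|Wij] := jump _ _ ij.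
  set Q := quotmod _; exists Q; last first.
    by apply: (@isomorphic_pack _ _ id) => // y; exists y.
  apply: C0 => q; have [x <-] := quot_pi_surj q.
  by apply/quot_pi_eq0; rewrite !inE; apply: Wij; apply: (valP x).
have [N CN [f fB]] := Fsucc _ _ ij; exists N => //.
have hF (x : submod (preimage_submod h (F j))) : h (val x) \in F j.
  exact: (valP x).
pose g x :=
  f (quot_pi (restrict_submod (F j) (F i)) (exist _ (h (val x)) (hF x))).
have [|g' g'E] := @linear_pack _ _ g.
  move=> a x y; rewrite /g -linearP -quot_piP; congr (f (quot_pi _ _)).
  by apply: val_inj; rewrite /= linearP.
apply: (@quotient_isomorphic _ _ _ g').
- move=> y; have [q <-] := bijective_surj fB y.
  have [[x xF] <-] := quot_pi_surj q.
  have [w wF xw] := Wij x xF.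
  exists (exist _ w wF); rewrite g'E /g; congr (f _); apply/quot_pi_eq.
  by rewrite !inE /= -opprB -scaleN1r rpredZ.
- move=> x; rewrite g'E /g -(linear0 f).
  split=> [/(bij_inj fB)/quot_pi_eq0|xF]; first by rewrite !inE.
  by congr (f _); apply/quot_pi_eq0; rewrite !inE.
Qed.

End LinearAlgebra.

(** * Purity with respect to systems of given sizes *)

Section Purity.
Variable R : pzRingType.
Implicit Types (V : rmodType R) (Q : nat -> nat -> Prop).

(** Q m n says that systems of m equations in n unknowns are tested; A and B lie
    in a common module so that chains need no change of ambient module. *)
Definition relatively_pure Q V (A B : {pred V}) : Prop :=
  forall m n, Q m n ->
  forall (r : 'I_m -> 'I_n -> R^c) (b : 'I_m -> V), (forall i, b i \in A) ->
  forall x : 'I_n -> V, (forall j, x j \in B) ->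
    (forall i, \sum_(j < n) r i j *: x j = b i) ->
  exists2 y : 'I_n -> V, forall j, y j \in A &
    forall i, \sum_(j < n) r i j *: y j = b i.

Lemma image_submod_incl V (S : submodClosed V) x :
  (x \in image_submod (submod_incl S)) = (x \in S).
Proof.
apply/asboolP/idP => [[y <-]|xS]; first exact: (valP y).
by exists (exist _ x xS).
Qed.

Lemma submod_incl_inj V (S : submodClosed V) : injective (submod_incl S).
Proof. by move=> x y xy; apply: val_inj. Qed.

Lemma embedding_pure V (S : submodClosed V) :
  embedding (submod_incl S) <-> relatively_pure (fun _ _ => False) S predT.
Proof. by split=> [_ m n []|_]; apply: submod_incl_inj. Qed.

Lemma RD_embedding_pure V (S : submodClosed V) :
  RD_embedding (submod_incl S) <->
  relatively_pure (fun m n => m = 1%N /\ n = 1%N) S predT.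
Proof.
split=> [[_ RD] _ _ [-> ->] r b bS x _ /(_ ord0) xE|pure].
  have [+ _] := RD (r ord0 ord0) (b ord0).
  rewrite image_submod_incl => -[].
    by split; [apply: bS|exists (x ord0); rewrite -xE big_ord1].
  move=> y; rewrite image_submod_incl => yS yE; exists (fun=> y) => // i.
  by rewrite [i]ord1 big_ord1 yE.
split=> [|r x]; first exact: submod_incl_inj.
rewrite image_submod_incl; split=> [[xS [y xE]]|[y]].
  have [|z zS /(_ ord0)] := pure 1%N 1%N (conj erefl erefl) (fun _ _ => r)
    (fun=> x) (fun=> xS) (fun=> y) (fun=> isT).
    by move=> i; rewrite big_ord1.
  rewrite big_ord1 => zE; exists (z ord0) => //.
  by rewrite image_submod_incl; apply: zS.
rewrite image_submod_incl => yS ->.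
by split; [apply: rpredZ|exists y].
Qed.

Lemma pure_embedding_pure V (S : submodClosed V) :
  pure_embedding (submod_incl S) <->
  relatively_pure (fun _ _ => True) S predT.
Proof.
split=> [[_ pure] m n _ r b bS x _ xE|pure].
  have [||y [yS yE]] := pure m n r b.
  - by move=> i; rewrite image_submod_incl; apply: bS.
  - by exists x.
  by exists y => // j; rewrite -image_submod_incl; apply: yS.
split=> [|m n r b bS [x xE]]; first exact: submod_incl_inj.
have [|//|//|y yS yE] := pure m n I r b _ x.
  by move=> i; rewrite -image_submod_incl; apply: bS.
by exists y; split=> // j; rewrite image_submod_incl; apply: yS.
Qed.

Lemma relatively_pure_refl Q V (A : {pred V}) : relatively_pure Q A A.
Proof. by move=> m n _ r b _ x xA xE; exists x. Qed.

Lemma relatively_pure_trans Q V (A B C : {pred V}) : {subset A <= B} ->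
  relatively_pure Q A B -> relatively_pure Q B C -> relatively_pure Q A C.
Proof.
move=> AB pAB pBC m n mn r b bA x xC xE.
have [|y yB yE] := pBC m n mn r b _ x xC xE; first by move=> i; apply: AB.
exact: pAB mn _ _ bA y yB yE.
Qed.

Lemma relatively_pure_sub Q V (A B C : {pred V}) : {subset B <= C} ->
  relatively_pure Q A C -> relatively_pure Q A B.
Proof.
move=> BC pAC m n mn r b bA x xB xE.
by apply: (pAC _ _ mn r b bA x) => // j; apply: BC.
Qed.

Lemma relatively_pure_restrict Q V (A B : submodClosed V) :
  {subset A <= B} ->
  relatively_pure Q (restrict_submod B A) predT <-> relatively_pure Q A B.
Proof.
move=> AB; split=> pAB m n mn r b bA x xB xE.
  pose b' i : submod B := exist _ (b i) (AB _ (bA i)).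
  pose x' j : submod B := exist _ (x j) (xB j).
  have [|//|i|y yA yE] := pAB m n mn r b' _ x'.
  - by move=> i; rewrite inE; apply: bA.
  - apply: val_inj; rewrite (linear_sum (submod_incl B)) -[RHS]xE.
    by apply: eq_bigr => j _; rewrite linearZ.
  exists (fun j => val (y j)) => [j|i]; first exact: yA.
  rewrite -[RHS]/(val (b' i)) -yE (linear_sum (submod_incl B)).
  by apply: eq_bigr => j _; rewrite linearZ.
have [||i|y yA yE] := pAB m n mn r (fun i => val (b i)) _ (fun j => val (x j)).
- by move=> i; apply: bA.
- by move=> j; apply: (valP (x j)).
- rewrite -xE (linear_sum (submod_incl B)).
  by apply: eq_bigr => j _; rewrite linearZ.
exists (fun j => exist _ (y j) (AB _ (yA j)) : submod B) => [j|i].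
  by rewrite inE; apply: yA.
apply: val_inj; rewrite (linear_sum (submod_incl B)) -yE.
by apply: eq_bigr => j _; rewrite linearZ.
Qed.

Lemma relatively_pure_iso Q V V' (f : {linear V -> V'}) (A : {pred V})
    (A' : {pred V'}) :
  bijective f -> (forall x, (f x \in A') = (x \in A)) ->
  relatively_pure Q A predT -> relatively_pure Q A' predT.
Proof.
move=> [g fK gK] fA pA m n mn r b bA x _ xE.
have [||i|y yA yE] := pA m n mn r (g \o b) _ (g \o x) => //.
- by move=> i; rewrite -fA /= gK.
- apply: (can_inj fK); rewrite linear_sum /= gK -xE.
  by apply: eq_bigr => j _; rewrite linearZ /= gK.
exists (f \o y) => [j|i]; first by rewrite /= fA.
rewrite -[RHS]gK -[g _]yE linear_sum.
by apply: eq_bigr => j _; rewrite linearZ.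
Qed.

End Purity.

(** * Well-ordered index sets *)

Section Ordinal.
Variable J : wordinal.

Lemma ord_le_anti (i j : J) : ord_le i j -> ord_le j i -> i = j.
Proof.
move=> ij ji.
have refl k : ord_le k k by case: (ord_total k k).
have [|k [kP kU]] := @ord_wo J [pred k | `[< k = i \/ k = j >]].
  by exists i; apply/asboolP; left.
have <- : k = i.
  by apply: kU; split=> [|_ /asboolP[->|->]//]; apply/asboolP; left.
by apply: kU; split=> [|_ /asboolP[->|->]//]; apply/asboolP; right.
Qed.

Lemma ord_le_trans (j i k : J) : ord_le i j -> ord_le j k -> ord_le i k.
Proof.
move=> ij jk.
have [|l [[/asboolP lE lP] _]] := @ord_wo J
  [pred l | `[< [\/ l = i, l = j | l = k] >]].
  by exists i; apply/asboolP; constructor 1.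
have [li lj lk] : [/\ ord_le l i, ord_le l j & ord_le l k].
  split; apply: lP; apply/asboolP.
  - by constructor 1.
  - by constructor 2.
  - by constructor 3.
case: lE => lE; subst l => //.
  by rewrite (ord_le_anti ij li).
by rewrite -(ord_le_anti jk lj).
Qed.

Lemma ord_lt_or_le (i j : J) : ord_lt i j \/ ord_le j i.
Proof.
have [ij|] := ord_total i j; last by right.
by have [E|ne] := pselect (i = j); [right; rewrite E in ij *|left].
Qed.

(** Applied to the property that x lies in F_k: the step of a filtration at
    which x enters depends on x only, so that the coset representatives for
    this step can be indexed by x. *)
Lemma ord_succ_unique (P : J -> Prop) (i j i' j' : J) :
  (forall k l, ord_le k l -> P k -> P l) ->
  ord_is_succ i j -> P j -> ~ P i -> ord_is_succ i' j' -> P j' -> ~ P i' ->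
  i = i' /\ j = j'.
Proof.
move=> mono.
have aux k l k' l' : ord_is_succ k l -> P l -> ~ P k -> ord_is_succ k' l' ->
    P l' -> ~ P k' -> ord_le k' k /\ ord_le l' l.
  move=> kl Pl nk kl' Pl' nk'.
  split.
    have [kk'|//] := ord_lt_or_le k k'.
    by case: nk'; apply: mono (proj2 kl _ kk') Pl.
  have [/(proj2 kl')//|lk'] := ord_lt_or_le k' l.
  by case: nk'; apply: mono lk' Pl.
move=> ij Pj ni ij' Pj' ni'.
have [a b] := aux _ _ _ _ ij Pj ni ij' Pj' ni'.
have [c d] := aux _ _ _ _ ij' Pj' ni' ij Pj ni.
by split; apply: ord_le_anti.
Qed.

(** With P k j the membership of x_j in F_k, this is directedness: finitely many
    elements of the union of a chain lie in one of its members. *)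
Lemma ord_bound n (u : 'I_n -> J) (i0 : J) (P : J -> 'I_n -> Prop) :
  (forall k l j, ord_le k l -> P k j -> P l j) -> (forall j, P (u j) j) ->
  exists2 k, ord_le i0 k & forall j, P k j.
Proof.
move=> mono Pu.
suff [k ik Pk] : exists2 k, ord_le i0 k & forall j, j \in enum 'I_n -> P k j.
  by exists k => // j; apply: Pk; rewrite mem_enum.
elim: (enum 'I_n) => [|j s [k ik Pk]].
  by exists i0 => //; case: (ord_total i0 i0).
have [ujk|kuj] := ord_total (u j) k.
  exists k => // l; rewrite inE => /orP[/eqP->|]; last exact: Pk.
  exact: mono ujk (Pu j).
exists (u j); first exact: ord_le_trans ik kuj.
move=> l; rewrite inE => /orP[/eqP->|/Pk]; first exact: Pu.
exact: mono kuj.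
Qed.

End Ordinal.

(** * Deconstructible classes *)

Section Deconstructible.
Variables (R : pzRingType) (kappa kappa_plus : cardinal).
Hypothesis nat_kappa : inj_le nat kappa.
Hypothesis R_kappa : inj_le R kappa.
Hypothesis kappa_succ : succ_cardinal kappa kappa_plus.
Implicit Types V W N : rmodType R.

Lemma inj_le_of_lt_succ (X : cardinal) :
  card_lt [set: X]%classic [set: kappa_plus]%classic -> inj_le X kappa.
Proof.
move=> [_ nle]; have [//|kX] := inj_le_total X kappa.
apply: contrapT => nXk; apply: nle; apply: (proj2 kappa_succ).
by split=> [|/card_leTP//]; apply/card_leTP.
Qed.

(** A finitely supported function is determined by its graph on its support,
    listed in some order. *)
Lemma inj_le_free_rmod (X : cardinal) :
  inj_le (free_rmod R X) (seq (X * R)).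
Proof.
elim/Pchoice: X => X.
have ex (f : free_rmod R X) :
    exists s : seq X, [set x | val f x != 0]%classic = [set` s]%classic.
  by apply/finite_seqP; apply/asboolP; apply: (valP f).
have [s sP] := choice ex.
exists (fun f => [seq (x, val f x : R) | x <- s f]) => f g fg.
have sfg : s f = s g.
  have := congr1 (map fst) fg.
  by rewrite -!map_comp !map_id_in.
apply: val_inj; apply: funext => x.
have sE (h : free_rmod R X) : (x \in s h) = (val h x != 0).
  have /(congr1 (fun A : set X => A x)) /= E := sP h.
  by apply/idP/idP => [|]; [rewrite E|rewrite -E].
have [xs|xs] := boolP (x \in s f); last first.
  have := xs; rewrite sE negbK => /eqP ->.
  by move: xs; rewrite sfg sE negbK => /eqP ->.
move: fg; rewrite -sfg => /eq_in_map/(_ x xs).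
by case.
Qed.

Lemma inj_le_lt_presented N : lt_presented kappa_plus N -> inj_le N kappa.
Proof.
move=> [X [Y [/inj_le_of_lt_succ Xk _ [f /bij_inj fI]]]].
have NQ : inj_le N (quotmod (span_submod Y)) by exists f.
apply: inj_le_trans NQ _.
apply: inj_le_trans (surj_inj_le (@quot_pi_surj _ _ (span_submod Y))) _.
apply: inj_le_trans (inj_le_free_rmod X) _.
by apply: inj_le_seqI => //; apply: inj_le_prodI.
Qed.

(** The zero module has the empty presentation; it is the factor of the
    filtration of a submodule at the steps where nothing new enters. *)
Lemma lt_presented_trivial N :
  (forall x : N, x = 0) -> lt_presented kappa_plus N.
Proof.
move=> N0; exists void, set0.
have lt0 (T : Type) (A : set T) : A = set0 ->
    card_lt A [set: kappa_plus]%classic.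
  move=> ->; split; first exact: card_ge0.
  rewrite card_le0 => /eqP k0; have [e _] := nat_kappa.
  have [/card_leTP[f _] _] := proj1 kappa_succ.
  by have : [set: kappa_plus]%classic (f (e 0%N)) by []; rewrite k0.
split; [|exact: lt0|].
  by apply: lt0; apply/seteqP; split=> -[].
apply: trivial_isomorphic => // q; have [x <-] := quot_pi_surj q.
apply/quot_pi_eq0.
suff -> : x = 0 by apply: rpred0.
by apply: val_inj; apply: funext => -[].
Qed.

Variable D : rmodType R -> Prop.
Hypothesis Ddec : deconstructible kappa_plus D.

Let C N := D N /\ lt_presented kappa_plus N.

Lemma unit_wo : well_order (fun _ _ : unit => true).
Proof.
move=> P [[] Px]; exists tt; split=> [|[] //].
by split.
Qed.

(** A filtration of length 0 has no factors. *)
Lemma deconstructible_trivial N : (forall x : N, x = 0) -> D N.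
Proof.
move=> N0; apply/Ddec.
have F : submodClosed N by exact: (span_submod set0).
exists (Wordinal unit_wo), tt, (fun=> F); split=> //.
- by move=> i j _ x.
- have F0 x : x \in F by rewrite (N0 x) rpred0.
  by split=> [i _ x|x]; rewrite F0 // (N0 x) eqxx.
- by move=> i [[]].
- by move=> [] [] [[_ []]].
Qed.

Lemma small_trivial N : (forall x : N, x = 0) -> C N.
Proof.
move=> N0; split; first exact: deconstructible_trivial.
exact: lt_presented_trivial.
Qed.

Lemma deconstructible_iso V W : isomorphic V W -> D V -> D W.
Proof.
move=> /isomorphic_sym[h hB] /Ddec[J [t [F filt]]]; apply/Ddec.
exists J, t, (fun j => preimage_submod h (F j)).
apply: filtration_preimage => //; first exact: bij_inj.
  exact: small_trivial.
move=> i j _; right=> y yF; have [w wy] := bijective_surj hB y.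
by exists w; rewrite wy // subrr rpred0.
Qed.

Lemma inj_le_surj (T K : Type) (x0 : T) :
  inj_le T K -> exists g : K -> T, forall y, exists k, g k = y.
Proof.
move=> [f fI]; pose P k x := (exists y, f y = k) -> f x = k.
have [k|g gP] := @choice K T P.
  by have [[y yk]|n] := pselect (exists y, f y = k); [exists y|exists x0].
exists g => y; exists (f y); apply: fI; apply: gP; by exists y.
Qed.

(** The step from i to j at which x enters the filtration is determined by x
    (ord_succ_unique), and F_j/F_i has at most kappa elements.  Hence a family
    of kappa representatives of its cosets can be attached to x alone, and
    these become unary operations on V. *)
Lemma jump_representatives V (J : wordinal) (t : J) (F : J -> submodClosed V) :
  filtration C t F ->
  exists rep : V -> kappa -> V, forall i j x,
    ord_is_succ i j -> x \in F j -> x \notin F i ->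
    forall y, y \in F j -> exists2 k, rep x k \in F j & y - rep x k \in F i.
Proof.
move=> [_ mono _ _ Fsucc].
pose P x (r : kappa -> V) := forall i j,
    ord_is_succ i j -> x \in F j -> x \notin F i ->
    forall y, y \in F j -> exists2 k, r k \in F j & y - r k \in F i.
have [x|rep repP] := @choice V (kappa -> V) P; last first.
  by exists rep => i j x; apply: repP.
have [[i [j [ij xj xi]]]|nx] := pselect (exists i j,
    [/\ ord_is_succ i j, x \in F j & x \notin F i]); last first.
  by exists (fun=> 0) => i j ij xj xi; case: nx; exists i, j.
have [N [_ Nsmall] [f /bij_inj fI]] := Fsucc _ _ ij.
have Nk := inj_le_lt_presented Nsmall.
have Qk : inj_le (quotmod (restrict_submod (F j) (F i))) kappa.
  by apply: inj_le_trans Nk; exists f.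
have [g gS] := inj_le_surj 0 Qk.
have [s sK] := choice (@quot_pi_surj _ _ (restrict_submod (F j) (F i))).
exists (fun k => val (s (g k))) => i' j' ij' xj' xi' y yF.
have [iE jE] : i = i' /\ j = j'.
  apply: (@ord_succ_unique _ (fun k => x \in F k)) => //.
  - by move=> k l /mono; apply.
  - exact/negP.
  - exact/negP.
subst i' j'.
pose y' : submod (F j) := exist _ y yF.
have [k gk] := gS (quot_pi _ y').
exists k; first exact: (valP (s (g k))).
have /quot_pi_eq : quot_pi (restrict_submod (F j) (F i)) y' =
  quot_pi _ (s (g k)) by rewrite sK.
by rewrite inE linearB.
Qed.

(** Lists with default values code systems of all sizes in a single type whose
    cardinality is easy to bound. *)
Definition solves V (rows : seq (seq R)) n (b : seq V) (x : nat -> V) : Prop :=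
  forall i, (i < size b)%N ->
    \sum_(j < n) (nth 0 (nth [::] rows i) j : R^c) *: x j = nth 0 b i.

Lemma solver V : exists sol : seq (seq R) -> nat -> seq V -> nat -> V,
  forall rows n b, (exists x, solves rows n b x) ->
    solves rows n b (sol rows n b).
Proof.
pose P (u : seq (seq R) * nat * seq V) x :=
  (exists x, solves u.1.1 u.1.2 u.2 x) -> solves u.1.1 u.1.2 u.2 x.
have [u|sol solP] := @choice _ _ P.
  by have [[x xs]|n] := pselect (exists x, solves u.1.1 u.1.2 u.2 x);
    [exists x|exists (fun=> 0)].
exists (fun rows n b => sol (rows, n, b)) => rows n b.
exact: (solP (rows, n, b)).
Qed.

(** A' is the closure of A under sums, scalars, coset representatives and
    solutions of systems.  Representatives make the filtration of V restrict to
    A', solutions make A' pure, and all operations together are indexed by a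
    set of at most kappa elements. *)
Lemma deconstructible_submodule V (A : submodClosed V) : D V ->
  exists A' : submodClosed V,
    [/\ D (submod A'), {subset A <= A'},
        forall Q, relatively_pure Q A' predT
      & inj_le (submod A') (submod A + kappa)].
Proof.
move=> /Ddec[J [t [F filt]]].
have [rep repP] := jump_representatives filt.
have [sol solP] := solver V.
pose Idx : Type := (unit + R + kappa + seq (seq R) * nat * nat)%type.
(* Sums, scalar multiplications, coset representatives and the j-th unknown of
   a system; the unary operations act on the first argument. *)
pose op (k : Idx) (s : seq V) : V := match k with
  | inl (inl (inl _)) => \sum_(x <- s) x
  | inl (inl (inr r)) => (r : R^c) *: head 0 s
  | inl (inr k) => rep (head 0 s) k
  | inr (rows, n, j) => sol rows n s j
  end.
have [S [SA Sop Scard]] := closure_exists (submod_incl A) op.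
have [|x y Sx Sy|a x Sx|A' A'S] := @submod_of_set _ _ S.
- have := Sop (inl (inl (inl tt))) [::].
  by rewrite /op big_nil; apply.
- have := Sop (inl (inl (inl tt))) [:: x; y].
  rewrite /op big_cons big_seq1; apply.
  by move=> z; rewrite !inE => /orP[]/eqP->.
- apply: (Sop (inl (inl (inr a))) [:: x]).
  by move=> z; rewrite inE => /eqP->.
exists A'; split.
- apply/Ddec; exists J, t, (fun j => preimage_submod (submod_incl A') (F j)).
  apply: (filtration_preimage _ small_trivial filt).
    exact: submod_incl_inj.
  move=> i j ij.
  have [[x [xA' xj xi]]|nx] :=
    pselect (exists x, [/\ x \in A', x \in F j & x \notin F i]).
    right=> y /(repP _ _ _ ij xj xi)[k kj ki].
    have kA' : rep x k \in A'.
      apply/A'S; apply: (Sop (inl (inr k)) [:: x]) => z.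
      by rewrite inE => /eqP->; apply/A'S.
    by exists (exist (fun z => z \in A') (rep x k) kA').
  left=> w wj; apply: contrapT => /negP wi; apply: nx.
  by exists (val w); split=> //; apply: (valP w).
- by move=> x xA; apply/A'S; apply: (SA (exist _ x xA)).
- move=> Q m' n _ r b bA' x _ xE.
  pose rows := [tuple [tuple r i j : R | j < n] : seq R | i < m'].
  pose s := [tuple b i | i < m'].
  have rowsE (i : 'I_m') (j : 'I_n) : nth 0 (nth [::] rows i) j = r i j.
    by rewrite -tnth_nth tnth_mktuple -tnth_nth tnth_mktuple.
  have sE (i : 'I_m') : nth 0 s i = b i by rewrite -tnth_nth tnth_mktuple.
  have solE : solves rows n s (sol rows n s).
    apply: solP; exists (fun j => if insub j is Some j' then x j' else 0).
    move=> i; rewrite size_tuple => lt.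
    have [i' ->] : exists i' : 'I_m', i = i' by exists (Ordinal lt).
    by rewrite sE -xE; apply: eq_bigr => j _; rewrite rowsE valK.
  exists (fun j : 'I_n => sol rows n s j) => [j|i].
    apply/A'S; apply: (Sop (inr (val rows, n, nat_of_ord j)) s).
    by move=> y /mapP[i _ ->]; apply/A'S; apply: bA'.
  have := solE i; rewrite size_tuple => /(_ (ltn_ord i)); rewrite sE => <-.
  by apply: eq_bigr => j _; rewrite rowsE.
- have kK : inj_le kappa (submod A + kappa) by exists inr => x y [].
  have natK := inj_le_trans nat_kappa kK; have RK := inj_le_trans R_kappa kK.
  have tK : inj_le {x | S x} (submod A + kappa).
    apply: inj_le_trans Scard _; apply: inj_le_treeI => //.
    apply: inj_le_sumI => //; first by exists inl => x y [].
    apply: inj_le_sumI => //; last first.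
      do 2?apply: inj_le_prodI => //; do 2!apply: inj_le_seqI => //.
    do 2?apply: inj_le_sumI => //.
    by apply: inj_le_trans natK; exists (fun=> 0%N) => -[] [].
  apply: inj_le_trans tK.
  exists (fun x : submod A' => exist S (val x) (proj1 (A'S _) (valP x))).
  by move=> x y [] /val_inj.
Qed.

End Deconstructible.

(** * The abstract elementary class *)

Lemma isomorphic_restrict (R : pzRingType) (V : rmodType R)
    (A B : submodClosed V) :
  {subset A <= B} -> isomorphic (submod (restrict_submod B A)) (submod A).
Proof.
move=> AB.
have inA (x : submod (restrict_submod B A)) : val (val x) \in A.
  exact: (valP x).
apply: (@isomorphic_pack _ _ _
  (fun x => exist _ (val (val x)) (inA x) : submod A)).
- by move=> a x y; apply: val_inj.
- by move=> x y [xy]; do 2!apply: val_inj.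
- move=> [y yA]; pose y' : submod B := exist _ y (AB y yA).
  have y'A : y' \in restrict_submod B A by [].
  by exists (exist _ y' y'A); apply: val_inj.
Qed.

Section ElementaryClass.
Variables (R : pzRingType) (D : rmodType R -> Prop).
Variable M : forall A B : rmodType R, {linear A -> B} -> Prop.
Variable Q : nat -> nat -> Prop.
Hypothesis D_iso : forall V W, isomorphic V W -> D V -> D W.
Hypothesis M_pure : forall (V : rmodType R) (S : submodClosed V),
  M (submod_incl S) <-> relatively_pure Q S predT.
Implicit Types V W : rmodType R.
Let K := class_of D M.

Lemma strongP V (A B : submodClosed V) :
  strong K A B <->
  [/\ {subset A <= B}, D (submod A), D (submod B) & relatively_pure Q A B].
Proof.
split=> [[AB [DA DB /M_pure pAB]]|[AB DA DB pAB]].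
  split=> //; first exact: D_iso (isomorphic_restrict AB) DA.
  exact/relatively_pure_restrict.
split=> //; split=> //.
  exact: D_iso (isomorphic_sym (isomorphic_restrict AB)) DA.
exact/M_pure/relatively_pure_restrict.
Qed.

Lemma abstract_class_of : abstract_class K.
Proof.
split=> [B A []||V W /D_iso //|B B' f A A' fB fA [DA DB /M_pure pA]] //.
- split=> [V A DA|V A B [AB _] [BA _] x|V A B C].
  + by apply/strongP; split=> //; apply: relatively_pure_refl.
  + by apply/idP/idP => [/AB|/BA].
  + move=> /strongP[AB DA _ pAB] /strongP[BC _ DC pBC]; apply/strongP.
    split=> // [x /AB/BC//|]; exact: relatively_pure_trans pAB pBC.
split; last exact/M_pure/(relatively_pure_iso fB fA).
  exact: D_iso (isomorphic_submod fB fA) DA.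
by apply: D_iso DB; exists f.
Qed.

Lemma coherence_of : coherence K.
Proof.
move=> V A B C DA DB _ /strongP[_ _ _ pAC] /strongP[BC _ _ _] AB.
by apply/strongP; split=> //; apply: relatively_pure_sub pAC.
Qed.

(** A system with a solution in the union, or with right-hand sides in the
    union, already has them in some member F_k of the chain, and purity of the
    inclusion of F_k in the other modules applies. *)
Lemma tarski_vaught_of : closed_under_unions K -> tarski_vaught K.
Proof.
move=> DU V I F U chain FU; have DFU := DU _ _ _ _ chain FU.
have [DF strongF _] := chain.
have [i0 _] := (proj1 (FU 0)) (rpred0 U).
have FsubU i : {subset F i <= U} by move=> x xi; apply/FU; exists i.
have bound n (u : 'I_n -> V) i : (forall j, u j \in U) ->
    exists2 k, ord_le i k & forall j, u j \in F k.
  move=> uU; have /choice[w wP] j : exists k, u j \in F k by apply/FU/uU.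
  have [k l j kl|//|k ik kP] := @ord_bound I n w i (fun k j => u j \in F k).
    have [Fkl _] := strongF _ _ kl; apply: Fkl.
  by exists k.
split=> // [i|N DN FN]; apply/strongP.
- split; [exact: FsubU|exact: DF|exact: DFU|].
  move=> m n mn r b bA x xU xE.
  have [k ik xk] := bound n x i xU.
  have /strongP[_ _ _ pF] := strongF _ _ ik.
  exact: pF mn r b bA x xk xE.
- split; [|exact: DFU|exact: DN|].
    by move=> x /FU[i xi]; have [FiN _] := FN i; apply: FiN.
  move=> m n mn r b bU x xN xE.
  have [k _ bk] := bound m b i0 bU.
  have /strongP[_ _ _ pF] := FN k.
  have [y yF yE] := pF m n mn r b bk x xN xE.
  by exists y => // j; apply: FsubU (yF j).
Qed.

End ElementaryClass.

Lemma LS_candidate_le (R : pzRingType) (K : rmod_class R) (L L' : cardinal) :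
  inj_le L L' -> LS_candidate K L -> LS_candidate K L'.
Proof.
move=> /[dup] LL' /card_leTP cLL' [/infiniteP natL RL bound]; split.
- exact/infiniteP/(card_le_trans natL).
- exact: card_le_trans cLL'.
- move=> B KB A; have [A' [KA' AA' A'B cA']] := bound B KB A.
  exists A'; split=> //; apply: card_le_trans cA' _.
  exact/card_leTP/(inj_le_sum (inj_le_refl _) LL').
Qed.

(** Candidates are closed upwards, so it is enough to minimize among those of
    the form of a subset of L0: a candidate not above L0 is equipotent to one
    of these.  This keeps the index type in the universe of cardinals. *)
Lemma least_LS (R : pzRingType) (K : rmod_class R) (L0 : cardinal) :
  LS_candidate K L0 ->
  exists2 L : cardinal, is_LS K L & [set: L]%classic #<= [set: L0]%classic.
Proof.
move=> K0; pose sub (A : set L0) : cardinal := {x | A x}.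
have KT : LS_candidate K (sub setT).
  by apply: LS_candidate_le K0; exists (fun x => exist _ x I) => x y [].
have [[A KA] Amin] := @inj_le_min {A : set L0 | LS_candidate K (sub A)}
  (exist _ setT KT) (fun A => sub (sval A)).
have AL0 : inj_le (sub A) L0 := inj_le_sig A.
exists (sub A); last exact/card_leTP.
split=> // L' KL'; apply/card_leTP.
have [L0L'|[f fI]] := inj_le_total L0 L'; first exact: inj_le_trans L0L'.
pose A' : set L0 := fun x => exists y, f y = x.
have KA' : LS_candidate K (sub A').
  apply: LS_candidate_le KL'.
  by exists (fun y => exist _ (f y) (ex_intro _ y erefl)) => x y [/fI].
apply: inj_le_trans (Amin (exist _ A' KA')) _.
apply: (surj_inj_le
  (f := fun y => exist A' (f y) (ex_intro _ y erefl) : sub A')).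
by move=> [x [y yx]]; exists y; apply: eq_exist.
Qed.

Theorem corollary2p9 (R : pzRingType) (kappa kappa_plus : cardinal)
    (hkappa : [set: R + nat]%classic #<= [set: kappa]%classic)
    (hkappa_plus : succ_cardinal kappa kappa_plus)
    (D : rmodType R -> Prop) (hD : deconstructible kappa_plus D)
    (M : forall A B : rmodType R, {linear A -> B} -> Prop)
    (hM : [\/ M = @embedding R, M = @RD_embedding R | M = @pure_embedding R]) :
  [/\ abstract_class (class_of D M), coherence (class_of D M)
    & lowenheim_skolem_tarski (class_of D M)] /\
  ((is_AEC (class_of D M) /\
    exists2 L : cardinal, is_LS (class_of D M) L
                        & [set: L]%classic #<= [set: kappa]%classic) <->
   closed_under_unions (class_of D M)).
Proof.
have /card_leTP RNk := hkappa.
have nk : inj_le nat kappa.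
  by apply: inj_le_trans RNk; exists inr => x y [].
have Rk : inj_le R kappa.
  by apply: inj_le_trans RNk; exists inl => x y [].
have Diso V W := @deconstructible_iso _ _ _ nk hkappa_plus _ hD V W.
have [Q M_pure] : exists Q, forall (V : rmodType R) (S : submodClosed V),
    M _ _ (submod_incl S) <-> relatively_pure Q S predT.
  case: hM => ->; eexists => V S.
  - exact: embedding_pure.
  - exact: RD_embedding_pure.
  - exact: pure_embedding_pure.
have absK := abstract_class_of Diso M_pure.
have cohK := coherence_of Diso M_pure.
have lstK : lst_bound (class_of D M) kappa.
  move=> B DB A.
  have [A' [DA' AA' pA' cA']] :=
    @deconstructible_submodule _ _ _ nk Rk hkappa_plus _ hD _ A DB.
  exists A'; split=> //; last exact/card_leTP.
  by split=> //; apply/M_pure.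
have LSTK : lowenheim_skolem_tarski (class_of D M) by exists kappa.
split=> //; split=> [[[_ TV _ _] _] V I F U FK FU|DU].
  by have [] := TV _ _ _ _ FK FU.
split; first by split=> //; apply: tarski_vaught_of Diso M_pure DU.
apply: least_LS; split=> //; last exact/card_leTP.
by apply/infiniteP/card_leTP.
Qed.
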